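(* Let $r<s$ and $m,x$ be positive integers, and let $q=(r^m,s^x)$, i.e. $m$ copies of $r$ followed by $x$ copies of $s$. Then $\Delta_{(1,q)}$ is reflexive if and only if $r\mid(1+sx)$ and $s\mid(1+rm)$. Further, $\Delta_{(1,q)}$ is reflexive and has the integer decomposition property if and only if either (1) $r\neq1$, $s=1+rm$ and $x=r-1$; or (2) $r=1$, $s=1+m$, and $x$ is arbitrary.
   Context: For $q=(q_1,\ldots,q_n)$, $\Delta_{(1,q)}:=\operatorname{conv}\{e_1,\ldots,e_n,-\sum_i q_ie_i\}\subset\mathbb{R}^n$. A lattice polytope containing $0$ in its interior is reflexive if its polar $\{y: x^Ty\le1\ \forall x\in P\}$ is a lattice polytope. A lattice polytope $P\subset\mathbb{R}^n$ has the integer decomposition property if for every positive integer $m'$ and every $w\in m'P\cap\mathbb{Z}^n$ there exist $x_1,\ldots,x_{m'}\in P\cap\mathbb{Z}^n$ with $w=x_1+\cdots+x_{m'}$. *)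

(* Defs.v *)
From mathcomp Require Import all_boot all_order all_algebra.
From mathcomp Require Import all_classical all_reals all_analysis.

Set Implicit Arguments.
Unset Strict Implicit.
Unset Printing Implicit Defensive.

Import GRing.Theory Num.Theory.
Import numFieldNormedType.Exports.

Local Open Scope classical_set_scope.
Local Open Scope ring_scope.

Section Polytopes.
Context {R : realType} {n : nat}.
Implicit Types (P : set 'rV[R]_n) (V : seq 'rV[R]_n).

Definition conv_hull V : set 'rV[R]_n :=
  [set p | exists a : 'I_(size V) -> R,
    [/\ forall i, 0 <= a i, \sum_i a i = 1 & p = \sum_i a i *: V`_i]].

Definition lattice_points : set 'rV[R]_n :=
  [set v | forall i, v ord0 i \is a Num.int].

Definition lattice_polytope P : Prop :=
  exists2 V, (forall v, v \in V -> lattice_points v) & P = conv_hull V.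

Definition dotmul (u v : 'rV[R]_n) : R := \sum_i u ord0 i * v ord0 i.

Definition polar P : set 'rV[R]_n :=
  [set y | forall p, P p -> dotmul p y <= 1].

(* Reflexivity is only defined for lattice polytopes with 0 in their interior;
   these two requirements are part of the predicate. *)
Definition reflexive_polytope P : Prop :=
  [/\ lattice_polytope P, interior P 0 & lattice_polytope (polar P)].

Definition dilate (k : nat) P : set 'rV[R]_n := [set k%:R *: p | p in P].

Definition has_IDP P : Prop :=
  lattice_polytope P /\
  forall k : nat, (0 < k)%N ->
  forall w, (dilate k P `&` lattice_points) w ->
  exists2 p : 'I_k -> 'rV[R]_n,
    (forall i, (P `&` lattice_points) (p i)) & w = \sum_i p i.

(* The simplex usually written Delta_(1,q). *)
Definition Delta (q : 'rV[nat]_n) : set 'rV[R]_n :=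
  conv_hull (- (\sum_i (q ord0 i)%:R *: delta_mx ord0 i)
        :: [seq delta_mx ord0 i | i <- enum 'I_n]).

End Polytopes.

Arguments Delta R {n} q.

Definition two_block (r m s x : nat) : 'rV[nat]_(m + x) :=
  row_mx (const_mx r) (const_mx s).

(* Main.v *)
Require Import Defs.
From mathcomp Require Import all_boot all_order all_algebra.
From mathcomp Require Import all_classical all_reals all_analysis.
From mathcomp Require Import zify ring lra.

(** Write [N = 1 + sum_i q_i].  The facets of [Delta_(1,q)] are cut out by
    [sum_j p_j <= 1] and [sum_j p_j - (N / q_i) p_i <= 1], so the polar has
    vertices [1] and [1 - (N / q_i) e_i], and reflexivity means that every [q_i]
    divides [N].

    A lattice point [z] of the [k]-th dilate is governed by the integer
    [t = k - sum_j z_j >= 0]: membership says [z_i >= - floor (t / l_i)] with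
    [l_i = N / q_i].  Let [a = N / r] and [b = N / s], so [b < a].  The point
    with [t = b] and coordinates [0] (first block), [-1] (second block) can
    only be decomposed if some lattice point of the simplex itself has [t = b],
    which forces [b = 1 + x], that is [s = 1 + r m].  If [r > 1], the same
    argument at [t = a] forces [1 + x = r].  Conversely, in both families every
    [t > 0] dominates some [u] belonging to a lattice point of the simplex with
    [u mod l_i <= t mod l_i] for all [i], so that this point can be split off
    and the decomposition proceeds by induction on [k]. *)

Set Implicit Arguments.
Unset Strict Implicit.
Unset Printing Implicit Defensive.

Import Order.TTheory GRing.Theory Num.Theory.
Import numFieldNormedType.Exports.

Local Open Scope classical_set_scope.
Local Open Scope ring_scope.

(** * Convex hulls of one point and an indexed family *)

Lemma conv_hull_consP (R : realType) (n k : nat) (v : 'rV[R]_n)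
    (f : 'I_k -> 'rV[R]_n) (p : 'rV[R]_n) :
  conv_hull (v :: [seq f i | i <- enum 'I_k]) p <->
  exists a0 (a : 'I_k -> R),
    [/\ 0 <= a0, forall i, 0 <= a i, a0 + \sum_i a i = 1 &
        p = a0 *: v + \sum_i a i *: f i].
Proof.
set V := v :: _.
(* Keeping the length [l] abstract lets the coefficients be indexed by ['I_k.+1], which equals
   ['I_(size V)] only propositionally. *)
have recast l (El : l = size V) : conv_hull V p <->
    exists c : 'I_l -> R,
      [/\ forall i, 0 <= c i, \sum_i c i = 1 & p = \sum_i c i *: V`_i].
  by rewrite El.
have El : k.+1 = size V by rewrite /V /= size_map size_enum_ord.
have nthV (i : 'I_k) : V`_(lift ord0 i) = f i.
  rewrite /V lift0 /= (nth_map i) ?size_enum_ord //.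
  by rewrite nth_ord_enum.
split.
  move=> /(recast _ El)[c [c0 c1 ->]].
  exists (c ord0), (fun i => c (lift ord0 i)).
  split=> //; first by rewrite -c1 big_ord_recl.
  by rewrite big_ord_recl; congr (_ + _); apply: eq_bigr => i _; rewrite nthV.
move=> [a0 [a [a0_ge0 a_ge0 a1 pE]]]; apply/(recast _ El).
exists (fun i => if unlift ord0 i is Some j then a j else a0); split.
- by move=> i; case: unliftP => [j _|_].
- rewrite big_ord_recl unlift_none -a1; congr (_ + _).
  by apply: eq_bigr => i _; rewrite liftK.
- rewrite pE big_ord_recl unlift_none; congr (_ + _).
  by apply: eq_bigr => i _; rewrite liftK nthV.
Qed.

Lemma sum_scale_delta (R : pzRingType) (n : nat) (a : 'I_n -> R) :
  \sum_i a i *: delta_mx ord0 i = \row_i a i :> 'rV[R]_n.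
Proof. by rewrite [RHS]row_sum_delta; apply: eq_bigr => i _; rewrite mxE. Qed.

(** * Facets, polar and reflexivity of a weighted simplex *)

Section WeightedSimplex.
Context (R : realType) (n : nat) (q : 'rV[nat]_n).

Definition total_weight : nat := (1 + \sum_i q ord0 i)%N.

Local Notation N := total_weight.

Lemma total_weightE (S : pzSemiRingType) :
  N%:R = 1 + \sum_i (q ord0 i)%:R :> S.
Proof. by rewrite /total_weight natrD natr_sum. Qed.

Lemma total_weight_gt0 : 0 < N%:R :> R.
Proof. by rewrite ltr0n. Qed.

(** The two expressions are [N] times the barycentric coordinates of [p] at the vertices [-q] and
    [e_i]. *)
Lemma DeltaP (p : 'rV[R]_n) :
  Delta R q p <->
  0 <= 1 - \sum_i p ord0 i /\
  forall i, 0 <= N%:R * p ord0 i + (q ord0 i)%:R * (1 - \sum_j p ord0 j).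
Proof.
have N0 := total_weight_gt0; have NE := total_weightE R.
split.
  move=> /conv_hull_consP[a0 [a [a0_ge0 a_ge0 a1 pE]]].
  have pi i : p ord0 i = a i - a0 * (q ord0 i)%:R.
    by rewrite pE !sum_scale_delta !mxE mulrN addrC.
  have tE : 1 - \sum_i p ord0 i = N%:R * a0.
    under eq_bigr do rewrite pi.
    by rewrite sumrB -mulr_sumr NE -[X in X - _]a1; ring.
  rewrite tE; split=> [|i]; first by rewrite mulr_ge0 // ltW.
  rewrite (_ : _ + _ = N%:R * a i); first by rewrite mulr_ge0 // ltW.
  by rewrite pi; ring.
set t := 1 - _ => -[t0 pt0]; apply/conv_hull_consP.
exists (t / N%:R), (fun i => p ord0 i + (q ord0 i)%:R * (t / N%:R)); split.
- by rewrite divr_ge0 // ltW.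
- move=> i; rewrite -(pmulr_rge0 _ N0); move: (pt0 i).
  by congr (_ <= _); field; rewrite gt_eqF.
- rewrite big_split /= -mulr_suml.
  have -> : \sum_i p ord0 i = 1 - t by rewrite /t; ring.
  have -> : \sum_i (q ord0 i)%:R = N%:R - 1 :> R by rewrite NE; ring.
  by field; rewrite gt_eqF.
- apply/rowP => i; rewrite !sum_scale_delta !mxE mulrN addrC.
  by rewrite [(q _ _)%:R * _]mulrC addrK.
Qed.

Lemma Delta_lattice_polytope : lattice_polytope (Delta R q).
Proof.
eexists; last by [].
move=> v; rewrite inE => /orP[/eqP ->|/mapP [j _ ->]] i; last first.
  by rewrite mxE rpred_nat.
rewrite mxE rpredN summxE rpred_sum // => j _.
by rewrite !mxE -natrM rpred_nat.
Qed.

Lemma Delta_interior0 (q_gt0 : forall i, (0 < q ord0 i)%N) :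
  interior (Delta R q) 0.
Proof.
have N0 := total_weight_gt0.
(* This radius gives [N e + n e <= 1], so [|p_i| <= e] implies [1 - \sum_j p_j >= N e], which
   outweighs [N p_i >= - N e] because [q_i >= 1]. *)
pose e : R := (N * n.+1)%:R^-1.
have e0 : 0 < e by rewrite invr_gt0 ltr0n muln_gt0.
rewrite /interior /=; apply/nbhs_ballP; exists e => //= p [_ pe].
have pie i : `|p ord0 i| <= e.
  by have := pe ord0 i; rewrite /ball /= mxE sub0r normrN => /ltW.
have eN : N%:R * (n.+1%:R * e) = 1.
  by rewrite mulrA -natrM /e divff // pnatr_eq0 muln_eq0.
have sum_le : \sum_i p ord0 i <= n%:R * e.
  apply: (le_trans (ler_sum _ (fun i _ => le_trans (ler_norm _) (pie i)))).
  by rewrite sumr_const card_ord mulr_natl.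
have ne : N%:R * e + n%:R * e <= 1.
  have le_n : n%:R * e <= N%:R * (n%:R * e).
    by rewrite ler_peMl ?ler1n ?mulr_ge0 ?(ltW e0).
  by move: eN; rewrite -natr1; nra.
have Ne0 : 0 <= N%:R * e by rewrite ltW ?mulr_gt0.
apply/DeltaP; split=> [|i]; first by lra.
have qi1 : 1 <= (q ord0 i)%:R :> R by rewrite ler1n.
have /ler_normlP [pi_ge _] := pie i.
have : N%:R * - p ord0 i <= N%:R * e by rewrite ler_pM2l.
set t := 1 - _; have t_ge : N%:R * e <= t by rewrite /t; lra.
by nra.
Qed.

Lemma polar_DeltaP (y : 'rV[R]_n) :
  polar (Delta R q) y <->
  (forall i, y ord0 i <= 1) /\ - \sum_i (q ord0 i)%:R * y ord0 i <= 1.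
Proof.
split.
  move=> py; split=> [i|].
    have /py : Delta R q (delta_mx ord0 i).
      apply/conv_hull_consP; exists 0, (fun j => (j == i)%:R); split=> //.
      - by rewrite add0r (bigD1 i) //= eqxx big1 ?addr0 // => j /negbTE ->.
      - rewrite scale0r add0r (bigD1 i) //= eqxx scale1r big1 ?addr0 //.
        by move=> j /negbTE ->; rewrite scale0r.
    rewrite /dotmul (bigD1 i) //= mxE !eqxx mul1r big1 ?addr0 // => j ji.
    by rewrite mxE (negbTE ji) andbF mul0r.
  have /py : Delta R q (- \row_i (q ord0 i)%:R).
    apply/DeltaP.
    have -> : \sum_i (- \row_i (q ord0 i)%:R) ord0 i = 1 - N%:R :> R.
      under eq_bigr do rewrite !mxE.
      by rewrite sumrN total_weightE; ring.
    rewrite opprB addrCA subrr addr0; split=> [|i]; first exact: ler0n.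
    by rewrite !mxE mulrN mulrC addNr.
  rewrite /dotmul -sumrN; congr (_ <= _); apply: eq_bigr => i _.
  by rewrite !mxE mulNr.
move=> [y1 qy1] _ /conv_hull_consP[a0 [a [a0_ge0 a_ge0 a1 ->]]].
set u := \sum_i (q ord0 i)%:R * y ord0 i in qy1 *.
have -> : dotmul (a0 *: - (\sum_i (q ord0 i)%:R *: delta_mx ord0 i) +
    \sum_i a i *: delta_mx ord0 i) y = a0 * - u + \sum_i a i * y ord0 i.
  rewrite !sum_scale_delta /dotmul /u -sumrN mulr_sumr -big_split /=.
  by apply: eq_bigr => i _; rewrite !mxE mulrDl mulrN mulNr mulrN mulrA.
rewrite -a1 lerD //; first by rewrite ler_piMr.
by apply: ler_sum => i _; rewrite ler_piMr.
Qed.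

Hypothesis q_gt0 : forall i, (0 < q ord0 i)%N.

(** The [i]-th coordinate attains its minimum [c = 1 - N / q_i] on the polar. A minimum over a
    convex hull is reached at one of the generators, so [c] is an integer. *)
Lemma polar_Delta_dvd :
  lattice_polytope (polar (Delta R q)) -> forall i, (q ord0 i %| N)%N.
Proof.
have NE := total_weightE R.
move=> [V latV pE] i.
have qi0 : 0 < (q ord0 i)%:R :> R by rewrite ltr0n.
pose c : R := 1 - N%:R / (q ord0 i)%:R.
have c_min y : polar (Delta R q) y -> c <= y ord0 i.
  move=> /polar_DeltaP[y1 qy].
  rewrite -(ler_pM2l qi0) /c mulrBr mulr1 mulrCA divff ?gt_eqF // mulr1.
  move: qy; rewrite NE (bigD1 i) //=.
  rewrite (bigD1 i (F := fun j => (q ord0 j)%:R)) //=.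
  have : \sum_(j | j != i) (q ord0 j)%:R * y ord0 j <=
         \sum_(j | j != i) (q ord0 j)%:R.
    by apply: ler_sum => j _; rewrite ler_piMr.
  lra.
pose v : 'rV[R]_n := \row_j (if j == i then c else 1).
have : polar (Delta R q) v.
  apply/polar_DeltaP; split=> [j|].
    rewrite mxE; case: eqP => // _.
    by rewrite /c gerBl divr_ge0.
  rewrite (bigD1 i) //= mxE eqxx.
  under eq_bigr => j ji do rewrite mxE (negbTE ji) mulr1.
  rewrite /c mulrBr mulr1 mulrCA divff ?gt_eqF // mulr1.
  rewrite NE (bigD1 i (F := fun j => (q ord0 j)%:R)) //=; lra.
rewrite pE => -[a [a_ge0 a1 vE]].
have inV (k : 'I_(size V)) : polar (Delta R q) V`_k.
  rewrite pE; exists (fun j => (j == k)%:R); split=> //.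
  - by rewrite (bigD1 k) //= eqxx big1 ?addr0 // => j /negbTE ->.
  - rewrite (bigD1 k) //= eqxx scale1r big1 ?addr0 // => j /negbTE ->.
    by rewrite scale0r.
(* The nonnegative gaps between the generators' [i]-th coordinates and [c] have weighted sum 0. If
   no gap vanished, all weights would be 0, yet they sum to 1. *)
have [k /eqP Vk] : exists k : 'I_(size V), V`_k ord0 i == c.
  apply/existsP; apply: contraT; rewrite negb_exists => /forallP Vc.
  have : \sum_k a k * (V`_k ord0 i - c) = 0.
    under eq_bigr do rewrite mulrBr.
    rewrite sumrB -mulr_suml a1 mul1r.
    have -> : \sum_k a k * V`_k ord0 i = v ord0 i.
      by rewrite vE summxE; apply: eq_bigr => k _; rewrite mxE.
    by rewrite mxE eqxx subrr.
  move=> /eqP; rewrite psumr_eq0 => [/allP a0|k _]; last first.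
    by rewrite mulr_ge0 // subr_ge0 c_min.
  have {}a0 k : a k = 0.
    have := a0 k (mem_index_enum _); rewrite mulf_eq0 subr_eq0 (negbTE (Vc k)).
    by rewrite orbF => /eqP.
  by move: a1; rewrite big1 // => /eqP; rewrite eq_sym oner_eq0.
have : c \is a Num.int by rewrite -Vk; apply: latV; apply: mem_nth.
rewrite /c => cint.
have : N%:R / (q ord0 i)%:R \is a @Num.int R.
  by rewrite -[X in X \is a _](subKr 1) rpredB // rpred1.
move=> /intrP[z zE].
have : (N%:R : R) = (z * (q ord0 i)%:Z)%:~R.
  by rewrite intrM -zE; field; rewrite gt_eqF.
move=> /eqP; rewrite -[N%:R]/(N%:Z%:~R) eqr_int => /eqP Nz.
suff : ((q ord0 i)%:Z %| N%:Z)%Z by rewrite dvdzE.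
by rewrite Nz dvdz_mull.
Qed.

Lemma dvd_polar_Delta :
  (forall i, (q ord0 i %| N)%N) -> lattice_polytope (polar (Delta R q)).
Proof.
move=> dvdq; have N0 := total_weight_gt0; have NE := total_weightE R.
pose l i : R := (N %/ q ord0 i)%:R.
have lE i : l i * (q ord0 i)%:R = N%:R by rewrite -natrM divnK.
pose one : 'rV[R]_n := const_mx 1.
have coordE a0 (a : 'I_n -> R) j : a0 + \sum_i a i = 1 ->
    (a0 *: one + \sum_i a i *: (one - l i *: delta_mx ord0 i)) ord0 j =
    1 - a j * l j.
  move=> a1.
  have -> : \sum_i a i *: (one - l i *: delta_mx ord0 i) =
      (\sum_i a i) *: one - \sum_i (a i * l i) *: delta_mx ord0 i.
    rewrite scaler_suml -sumrB; apply: eq_bigr => i _.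
    by rewrite scalerBr scalerA.
  rewrite addrA -scalerDl a1 scale1r !mxE summxE (bigD1 j) //= !mxE !eqxx mulr1.
  rewrite big1 ?addr0 // => k kj.
  by rewrite !mxE [j == k]eq_sym (negbTE kj) mulr0.
exists (one :: [seq one - l i *: delta_mx ord0 i | i <- enum 'I_n]).
  move=> v; rewrite inE => /orP[/eqP ->|/mapP [j _ ->]] i.
    by rewrite mxE rpred1.
  by rewrite !mxE rpredB ?rpred1 // -natrM rpred_nat.
apply/seteqP; split=> y.
  move=> /polar_DeltaP[y1 qy].
  (* The weights come from solving [y_i = 1 - a_i l_i]. *)
  pose a i := (1 - y ord0 i) * (q ord0 i)%:R / N%:R.
  have sa : \sum_i a i = (N%:R - 1 - \sum_i (q ord0 i)%:R * y ord0 i) / N%:R.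
    rewrite /a -mulr_suml; congr (_ / _); rewrite NE [1 + _]addrC addrK -sumrB.
    by apply: eq_bigr => i _; ring.
  apply/conv_hull_consP; exists (1 - \sum_i a i), a; split.
  - by rewrite sa subr_ge0 ler_pdivrMr // mul1r; lra.
  - by move=> i; rewrite /a divr_ge0 ?mulr_ge0 ?subr_ge0 // ltW.
  - by rewrite subrK.
  - apply/rowP => j; rewrite coordE ?subrK // /a -(lE j).
    have qj : (q ord0 j)%:R != 0 :> R by rewrite pnatr_eq0 -lt0n.
    have lj : l j != 0.
      by apply/eqP => l0; move: N0; rewrite -(lE j) l0 mul0r ltxx.
    by field; rewrite qj lj.
move=> /conv_hull_consP[a0 [a [a0_ge0 a_ge0 a1 ->]]].
set p := (X in polar _ X).
have pj j : p ord0 j = 1 - a j * l j by rewrite /p coordE.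
apply/polar_DeltaP; split=> [j|]; first by rewrite pj gerBl mulr_ge0.
have -> : \sum_i (q ord0 i)%:R * p ord0 i = N%:R - 1 - N%:R * \sum_i a i.
  have -> : N%:R - 1 = \sum_i (q ord0 i)%:R :> R.
    by rewrite NE addrAC subrr add0r.
  rewrite mulr_sumr -sumrB; apply: eq_bigr => i _.
  by rewrite pj -(lE i); ring.
have : \sum_i a i <= 1 by rewrite -a1 lerDr.
by rewrite -(ler_pM2l N0); lra.
Qed.

Lemma reflexive_DeltaP :
  reflexive_polytope (Delta R q) <-> forall i, (q ord0 i %| N)%N.
Proof.
split=> [[_ _]|dvdq]; first exact: polar_Delta_dvd.
split; [exact: Delta_lattice_polytope | exact: Delta_interior0 |].
exact: dvd_polar_Delta.
Qed.

End WeightedSimplex.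

(** * Integer points of dilates and the integer decomposition property *)

Section LatticePoints.
Context (R : realType) (n : nat) (q : 'rV[nat]_n).
Local Notation N := (total_weight q).

(* The facet inequalities of the [k]-th dilate; [k - \sum_i z_i] is [N] times
   the barycentric coordinate of the vertex [-q]. *)
Definition dilate_int (k : nat) (z : 'rV[int]_n) : Prop :=
  0 <= k%:Z - \sum_i z ord0 i /\
  forall i,
    0 <= N%:Z * z ord0 i + (q ord0 i)%:Z * (k%:Z - \sum_j z ord0 j).

Lemma Delta_intP (z : 'rV[int]_n) :
  Delta R q (map_mx intr z) <-> dilate_int 1 z.
Proof.
have sumE : \sum_i (map_mx intr z : 'rV[R]_n) ord0 i = (\sum_i z ord0 i)%:~R.
  by rewrite rmorph_sum /=; apply: eq_bigr => i _; rewrite mxE.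
have t_ge0 : (0 <= 1 - (\sum_i z ord0 i)%:~R :> R) = (0 <= 1 - \sum_i z ord0 i).
  by rewrite -(ler0z R) rmorphB.
have c_ge0 i : (0 <= N%:R * (z ord0 i)%:~R +
      (q ord0 i)%:R * (1 - (\sum_i z ord0 i)%:~R) :> R) =
    (0 <= N%:Z * z ord0 i + (q ord0 i)%:Z * (1 - \sum_j z ord0 j)).
  by rewrite -(ler0z R) rmorphD !rmorphM rmorphB.
split.
  move=> /DeltaP; rewrite sumE t_ge0 => -[t0 c0]; split=> // i.
  by have := c0 i; rewrite mxE c_ge0.
by move=> [t0 c0]; apply/DeltaP; rewrite sumE t_ge0; split=> // i;
   rewrite mxE c_ge0.
Qed.

Lemma dilate_DeltaP (k : nat) (z : 'rV[int]_n) : (0 < k)%N ->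
  dilate k (Delta R q) (map_mx intr z) <-> dilate_int k z.
Proof.
move=> k0; have k0R : 0 < k%:R :> R by rewrite ltr0n.
have kN0 : k%:R != 0 :> R by rewrite gt_eqF.
pose p : 'rV[R]_n := k%:R^-1 *: map_mx intr z.
have dilE : dilate k (Delta R q) (map_mx intr z) <-> Delta R q p.
  split=> [[u Du uE]|Dp]; last first.
    by exists p => //; rewrite /p scalerA divff ?scale1r.
  by rewrite /p -uE scalerA mulVf // scale1r.
have sumE : k%:R * (1 - \sum_i p ord0 i) = (k%:Z - \sum_i z ord0 i)%:~R.
  rewrite rmorphB /= rmorph_sum /= mulrBr mulr1 mulr_sumr; congr (_ - _).
  by apply: eq_bigr => i _; rewrite !mxE mulVKf.
have t_ge0 : (0 <= 1 - \sum_i p ord0 i) = (0 <= k%:Z - \sum_i z ord0 i).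
  by rewrite -(ler0z R) -sumE pmulr_rge0.
have c_ge0 i : (0 <= N%:R * p ord0 i + (q ord0 i)%:R * (1 - \sum_i p ord0 i)) =
    (0 <= N%:Z * z ord0 i + (q ord0 i)%:Z * (k%:Z - \sum_j z ord0 j)).
  rewrite -(ler0z R) rmorphD !rmorphM /= -sumE -(pmulr_rge0 _ k0R) mulrDr.
  by congr (_ <= _ + _); [rewrite !mxE mulrCA mulVKf | rewrite mulrCA].
split=> [/dilE/DeltaP[]|[t0 c0]].
  by rewrite t_ge0 => t0 c0; split=> // i; rewrite -c_ge0.
by apply/dilE/DeltaP; rewrite t_ge0; split=> // i; rewrite c_ge0.
Qed.

Lemma lattice_pointsP (w : 'rV[R]_n) :
  lattice_points w <-> exists z : 'rV[int]_n, w = map_mx intr z.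
Proof.
split=> [wint|[z ->] i]; last by rewrite mxE intr_int.
exists (\row_i Num.floor (w ord0 i)); apply/rowP => i.
by rewrite !mxE floorK.
Qed.

Lemma has_IDP_DeltaP :
  has_IDP (Delta R q) <->
  forall (k : nat) (z : 'rV[int]_n), (0 < k)%N -> dilate_int k z ->
  exists2 p : 'I_k -> 'rV[int]_n, (forall i, dilate_int 1 (p i)) &
    z = \sum_i p i.
Proof.
have sumE k (y : 'I_k -> 'rV[int]_n) :
    \sum_i (map_mx intr (y i) : 'rV[R]_n) = map_mx intr (\sum_i y i).
  by rewrite raddf_sum.
split=> [[_ idp] k z k0 Dz|idp].
  have [|p Dp pE] := idp k k0 (map_mx intr z).
    split; first exact/dilate_DeltaP.
    by apply/lattice_pointsP; exists z.
  have /choice [y yE] i : exists y : 'rV[int]_n, p i = map_mx intr y.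
    by apply/lattice_pointsP; case: (Dp i).
  exists y => [i|]; first by apply/Delta_intP; rewrite -yE; case: (Dp i).
  apply/rowP => i; apply: (@intr_inj R).
  move: pE; under eq_bigr do rewrite yE.
  by rewrite sumE => /rowP/(_ i); rewrite !mxE.
split; first exact: Delta_lattice_polytope.
move=> k k0 w [Dw /lattice_pointsP[z wE]]; rewrite {}wE in Dw *.
move/(dilate_DeltaP _ k0): Dw => Dz.
have [y Dy ->] := idp k z k0 Dz.
exists (fun i => map_mx intr (y i)) => [i|]; last by rewrite sumE.
by split; [exact/Delta_intP | apply/lattice_pointsP; exists (y i)].
Qed.

(** Adding the inequalities over all [i] gives [S >= 0] for the coordinate sum [S], and the
    remaining one gives [S <= 0]. This is the base case of the induction in [has_IDP_step]. *)
Lemma dilate_int0 (z : 'rV[int]_n) : dilate_int 0 z -> z = 0.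
Proof.
rewrite /dilate_int sub0r => -[t0 c0].
have : 0 <= \sum_i (N%:Z * z ord0 i + (q ord0 i)%:Z * - \sum_j z ord0 j).
  by apply: sumr_ge0 => i _.
rewrite big_split /= -mulr_sumr -mulr_suml.
have := total_weightE q int; rewrite natz => ->.
have -> : \sum_i (q ord0 i)%:R = \sum_i (q ord0 i)%:Z.
  by apply: eq_bigr => i _; rewrite natz.
set Q := \sum_i (q ord0 i)%:Z; set S := \sum_i z ord0 i in t0 *.
have -> : (1 + Q) * S + Q * - S = S by ring.
move=> S0; have s0 : S = 0 by lia.
have z0 i : 0 <= z ord0 i.
  by have := c0 i; rewrite -/S s0 oppr0 mulr0 addr0 pmulr_rge0 // ltz_nat.
apply/rowP => i; rewrite mxE.
move/eqP: s0; rewrite /S psumr_eq0 // => /allP /(_ i (mem_index_enum _)) /eqP.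
exact.
Qed.

Lemma has_IDP_step :
  (forall (k : nat) (z : 'rV[int]_n), dilate_int k.+1 z ->
     exists2 y, dilate_int 1 y & dilate_int k (z - y)) ->
  has_IDP (Delta R q).
Proof.
move=> step; apply/has_IDP_DeltaP => k z _.
elim: k z => [|k IHk] z Dz.
  by exists (fun=> 0) => [[]//|]; rewrite big_ord0 (dilate_int0 Dz).
have [y Dy /IHk[p Dp pE]] := step k z Dz.
exists (fun i => if unlift ord0 i is Some j then p j else y).
  by move=> i; case: unliftP => [j _|_].
rewrite big_ord_recl unlift_none.
under eq_bigr do rewrite liftK.
by rewrite -pE addrC subrK.
Qed.

(* A lattice point of the cone over the simplex lying [t] units away from the
   facet opposite to the vertex [-q] has coordinates at least [-(t %/ l i)],
   so it suffices to split off a height-one point [-(t' %/ l i)]_i such that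
   no coordinate loses a carry. *)
Lemma has_IDP_no_carry (l : 'I_n -> nat) :
  (forall i, l i * q ord0 i = N)%N ->
  (forall t, (0 < t)%N -> exists t', [/\ (t' <= t)%N,
     t' = (1 + \sum_i t' %/ l i)%N &
     forall i, (t' %/ l i + (t - t') %/ l i = t %/ l i)%N]) ->
  has_IDP (Delta R q).
Proof.
move=> lE split_t; apply: has_IDP_step => k z [].
set t := k.+1%:Z - _ => t0 c0.
have N0 : (0 < N)%N by [].
have sumBE (w : 'rV[int]_n) :
    \sum_j (z - w) ord0 j = \sum_j z ord0 j - \sum_j w ord0 j.
  by rewrite -sumrB; apply: eq_bigr => j _; rewrite !mxE.
(* On the facet [t = 0] the coordinates are nonnegative with positive sum [k.+1], so some [e_i]
   splits off. *)
have [/eqP tz|tnz] := boolP (t == 0).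
  have z0 i : 0 <= z ord0 i.
    by have := c0 i; rewrite tz mulr0 addr0 pmulr_rge0 // ltz_nat.
  have sz : \sum_i z ord0 i = k.+1%:Z by move: tz; rewrite /t; lia.
  have [i zi] : exists i, z ord0 i != 0.
    apply/existsP; apply: contraT; rewrite negb_exists => /forallP zi.
    by move: sz; rewrite big1 // => i _; apply/eqP; move: (zi i); rewrite negbK.
  have sd : \sum_j (delta_mx ord0 i : 'rV[int]_n) ord0 j = 1.
    rewrite (bigD1 i) //= mxE !eqxx big1 ?addr0 // => j ji.
    by rewrite mxE (negbTE ji) andbF.
  exists (delta_mx ord0 i).
    rewrite /dilate_int sd subrr; split=> // j; rewrite mulr0 addr0 mulr_ge0 //.
    by rewrite mxE.
  have -> : dilate_int k (z - delta_mx ord0 i) =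
      (0 <= t /\ forall j, 0 <= N%:Z * (z - delta_mx ord0 i) ord0 j +
         (q ord0 j)%:Z * t).
    rewrite /dilate_int.
    suff -> : \sum_j (z - delta_mx ord0 i) ord0 j = k%:Z - t.
      by rewrite subKr.
    by rewrite sumBE sd sz tz; lia.
  rewrite tz; split=> // j; rewrite mulr0 addr0 mulr_ge0 // !mxE eqxx /=.
  by case: eqP => [->|_]; have := z0 j; have := z0 i; move: zi; lia.
have [u tE] : exists u : nat, t = u%:Z by exists `|t|%N; lia.
have u0 : (0 < u)%N by lia.
have [t' [t'u t'E carry]] := split_t u u0.
pose y : 'rV[int]_n := \row_i - (t' %/ l i)%:Z.
have sy : \sum_i y ord0 i = 1 - t'%:Z.
  under eq_bigr do rewrite mxE.
  rewrite sumrN [in RHS]t'E PoszD opprD addrA subrr add0r; congr (- _).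
  by rewrite -natz natr_sum; apply: eq_bigr => i _; rewrite natz.
have qlE i : N%:Z = (q ord0 i)%:Z * (l i)%:Z by rewrite -(lE i); lia.
have li0 i : (0 < l i)%N by move: N0; rewrite -(lE i) muln_gt0 => /andP[].
have cE i (v w : int) :
    0 <= N%:Z * v + (q ord0 i)%:Z * w <-> 0 <= (l i)%:Z * v + w.
  have qi0 : (0 < q ord0 i)%N by move: N0; rewrite -(lE i) muln_gt0 => /andP[].
  by rewrite (qlE i) -mulrA -mulrDr pmulr_rge0 // ltz_nat.
exists y.
  rewrite /dilate_int sy subKr; split=> // i; apply/cE; rewrite mxE.
  have := divn_eq t' (l i); have := ltn_pmod t' (li0 i); nia.
have sE : k%:Z - \sum_j (z - y) ord0 j = (u - t')%:Z.
  by rewrite sumBE sy; move: tE; rewrite /t -subzn //; lia.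
rewrite /dilate_int sE; split=> // i; apply/cE; rewrite !mxE opprK.
have /cE : 0 <= N%:Z * z ord0 i + (q ord0 i)%:Z * t := c0 i.
rewrite tE => c0i.
have := carry i; have := divn_eq u (l i); have := ltn_pmod u (li0 i).
have := divn_eq (u - t') (l i).
move: (li0 i) c0i; move: (z ord0 i) (l i) => zi li.
set A := (u %/ li)%N; set B := ((u - t') %/ li)%N; set C := (t' %/ li)%N.
move=> li_gt0 c0i uE' u_mod uE AE.
(* As [zi] is an integer, [li * zi + u >= 0] rounds to [zi >= - A]. With [A = C + B] this gives
   [zi + C >= - B], the bound needed for [z - y]. *)
have zA : - A%:Z <= zi.
  by rewrite leNgt; apply/negP => zA; nia.
nia.
Qed.

(* Some summand has a negative [i]-th coordinate, and the facet inequality then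
   makes it carry the whole of [k - \sum_j z_j]. *)
Lemma has_IDP_full_weight (k : nat) (z : 'rV[int]_n) (i : 'I_n) :
  (forall j, (0 < q ord0 j)%N) ->
  has_IDP (Delta R q) -> (0 < k)%N -> dilate_int k z -> z ord0 i = -1 ->
  (q ord0 i)%:Z * (k%:Z - \sum_j z ord0 j) = N%:Z ->
  exists2 p, dilate_int 1 p & 1 - \sum_j p ord0 j = k%:Z - \sum_j z ord0 j.
Proof.
move=> q_gt0 /has_IDP_DeltaP idp k0 Dz zi zE.
have [p Dp pE] := idp k z k0 Dz.
have [j pj] : exists j, p j ord0 i < 0.
  apply/existsP; apply: contraT; rewrite negb_exists => /forallP pj.
  have : 0 <= z ord0 i; last by rewrite zi.
  by rewrite pE summxE sumr_ge0 // => j _; rewrite leNgt.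
exists (p j) => //; have [tj0 cj] := Dp j.
set t := k%:Z - _ in zE *.
have tE : t = \sum_a (1 - \sum_b p a ord0 b).
  rewrite /t pE sumrB sumr_const card_ord exchange_big /=; congr (_ - _).
    by rewrite natz.
  by apply: eq_bigr => b _; rewrite summxE.
(* The upper bound holds since [t] is a sum of nonnegative contributions of the summands. The lower
   one holds since [p j] has [i]-th coordinate at most -1, so its contribution times [q_i] is at
   least [N]. *)
apply/eqP; rewrite eq_le; apply/andP; split.
  rewrite tE (bigD1 j) //= lerDl sumr_ge0 // => a _.
  by case: (Dp a).
have q0 : 0 < (q ord0 i)%:Z by rewrite ltz_nat.
rewrite -(ler_pM2l q0) zE; have := cj i; nia.
Qed.

End LatticePoints.

(** * Carry-free splitting of natural numbers *)

Lemma divn_no_carry (d t u : nat) : (u <= t)%N -> (u %% d <= t %% d)%N ->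
  (u %/ d + (t - u) %/ d = t %/ d)%N.
Proof.
have [->|d0] := posnP d; first by rewrite !divn0.
move=> ut umod; have udiv : (u %/ d <= t %/ d)%N by apply: leq_div2r.
have -> : (t - u = (t %/ d - u %/ d) * d + (t %% d - u %% d))%N.
  by rewrite {1}(divn_eq t d) {1}(divn_eq u d) mulnBl; nia.
rewrite divnMDl // (divn_small (m := t %% d - u %% d)) ?addn0 ?subnKC //.
exact: leq_ltn_trans (leq_subr _ _) (ltn_pmod _ d0).
Qed.

Section TwoBlockSplitting.
Local Open Scope nat_scope.

(** For [r = 1] and [s = 1 + m], [N = a] and [N / s = b]. Since [b] divides [a], take [u = a] if [a]
    divides [t], else [u = b] if [b] divides [t], else [u = 1]. *)
Lemma split_no_carry_r1 (m x t : nat) : 0 < m -> 0 < x -> 0 < t ->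
  let a := m.+1 * x.+1 in let b := x.+1 in
  exists u, [/\ u <= t, u = 1 + (m * (u %/ a) + x * (u %/ b)),
    u %% a <= t %% a & u %% b <= t %% b].
Proof.
move=> m0 x0 t0 a b; have b1 : 1 < b by [].
have ab : b < a by rewrite /a /b; nia.
have a1 : 1 < a by apply: ltn_trans ab.
have bDa : b %| a by apply: dvdn_mull.
have [ta0|ta] := posnP (t %% a).
  exists a; rewrite !modnn divnn (ltnW a1).
  have -> : a %/ b = m.+1 by rewrite mulnK.
  split=> //; first by apply: dvdn_leq => //; apply/eqP.
    by rewrite /a; lia.
  by have/eqP -> : b %| a.
have [tb0|tb] := posnP (t %% b).
  have ba_t : b <= t %% a.
    by apply: dvdn_leq => //; rewrite /dvdn modn_dvdm // tb0.
  exists b; rewrite modnn divnn (ltnW b1) (divn_small ab) (modn_small ab).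
  split=> //; last by lia.
  exact: leq_trans ba_t (leq_mod _ _).
exists 1; rewrite (divn_small a1) (divn_small b1) (modn_small a1).
by rewrite (modn_small b1); split=> //; lia.
Qed.

(** For [s = 1 + r m] and [x = r - 1], [N = r s], so the moduli [N / r] and [N / s] are [s] and [r].
    The candidates for [u] are [r s], [s], [1], [r] and, in one residual case, [t] itself. *)
Lemma split_no_carry_gt1 (r m t : nat) : 1 < r -> 0 < m -> 0 < t ->
  let s := 1 + r * m in
  exists u, [/\ u <= t, u = 1 + (m * (u %/ s) + (r - 1) * (u %/ r)),
    u %% s <= t %% s & u %% r <= t %% r].
Proof.
move=> r1 m0 t0 s; have rs : r < s by rewrite /s; nia.
have s1 : 1 < s by apply: ltn_trans rs.
have [r0 s0] : 0 < r /\ 0 < s by lia.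
have [Nt|tN] := leqP (r * s) t.
  exists (r * s); rewrite modnMl modnMr mulnK // mulKn //.
  by split=> //; rewrite /s; nia.
have smod : s %% r = 1 by rewrite /s addnC mulnC modnMDl modn_small.
have sdiv : s %/ r = m by rewrite /s addnC mulnC divnMDl // divn_small ?addn0.
have tE := divn_eq t s; have al_r : t %/ s < r by rewrite ltn_divLR.
have [ts0|ts] := posnP (t %% s).
  rewrite ts0 addn0 in tE.
  have st : s <= t by apply: dvdn_leq => //; apply/eqP.
  have al0 : 0 < t %/ s by rewrite divn_gt0.
  exists s; rewrite modnn divnn s0 smod sdiv; split=> //.
    by rewrite /s; nia.
  (* As [s] is 1 modulo [r], [t %% r] is the quotient [t %/ s], which lies strictly between 0 and
     [r]. *)
  by rewrite tE -modnMmr smod muln1 modn_small.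
have [tr0|tr] := posnP (t %% r); last first.
  exists 1; rewrite (divn_small s1) (divn_small r1) (modn_small s1).
  by rewrite (modn_small r1); split=> //; lia.
have [rbe|ber] := leqP r (t %% s).
  exists r; rewrite modnn divnn r0 (divn_small rs) (modn_small rs); split=> //.
    exact: leq_trans rbe (leq_mod _ _).
  by lia.
(* Residual case: [r] divides [t] and [0 < t %% s < r]. The sum of quotient and remainder is a
   multiple of [r] strictly between 0 and [2 r], hence [r]; then [t] satisfies the equation required
   of [u]. *)
have dvd_sum : r %| t %/ s + t %% s.
  have : r %| t by apply/eqP.
  by rewrite {1}tE /s mulnDr muln1 mulnCA addnAC dvdn_addl // dvdn_mulr.
have sumE : t %/ s + t %% s = r.
  case/dvdnP: dvd_sum => c cE.
  have : c < 2 by rewrite -(ltn_pmul2r r0) -cE; lia.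
  by case: c cE => [|[|c]]; lia.
have t_r : t = r * (t %/ s * m + 1) by rewrite {1}tE {2}/s; nia.
exists t; split=> //.
have -> : t %/ r = t %/ s * m + 1 by rewrite {1}t_r mulKn.
by rewrite {1}t_r; nia.
Qed.

End TwoBlockSplitting.

(** * Weight vectors with two distinct values *)

Section TwoBlock.
Context (R : realType) (r m s x : nat).
Local Notation q := (two_block r m s x).
Local Notation Nq := (1 + r * m + s * x)%N.

Lemma two_blockP (i : 'I_(m + x)) :
  (exists2 j, i = lshift x j & q ord0 i = r) \/
  (exists2 j, i = rshift m j & q ord0 i = s).
Proof.
by case: (split_ordP i) => j ->; [left | right]; exists j => //;
  rewrite ?row_mxEl ?row_mxEr mxE.
Qed.

Lemma sum_two_block (F : nat -> nat) :
  (\sum_i F (q ord0 i) = m * F r + x * F s)%N.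
Proof.
rewrite big_split_ord /=; congr addn.
  by under eq_bigr do rewrite row_mxEl mxE; rewrite sum_nat_const card_ord.
by under eq_bigr do rewrite row_mxEr mxE; rewrite sum_nat_const card_ord.
Qed.

Lemma total_weight_two_block : total_weight q = Nq.
Proof. by rewrite /total_weight (sum_two_block id); lia. Qed.

Lemma two_block_gt0 : (0 < r)%N -> (0 < s)%N -> forall i, (0 < q ord0 i)%N.
Proof. by move=> r0 s0 i; case: (two_blockP i) => -[j _ ->]. Qed.

Lemma two_block_dvdP : (0 < m)%N -> (0 < x)%N ->
  (forall i, (q ord0 i %| Nq)%N) <->
  (r %| 1 + s * x)%N /\ (s %| 1 + r * m)%N.
Proof.
move=> m0 x0.
have -> : (r %| 1 + s * x)%N = (r %| Nq)%N.
  by rewrite addnAC [RHS]dvdn_addl // dvdn_mulr.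
have -> : (s %| 1 + r * m)%N = (s %| Nq)%N.
  by rewrite [RHS]dvdn_addl // dvdn_mulr.
split=> [dvdq|[dr ds] i]; last by case: (two_blockP i) => -[j _ ->].
have := dvdq (lshift x (Ordinal m0)); have := dvdq (rshift m (Ordinal x0)).
by rewrite row_mxEl row_mxEr !mxE.
Qed.

Definition two_blockz (c d : int) : 'rV[int]_(m + x) :=
  row_mx (const_mx c) (const_mx d).

Lemma sum_two_blockz (c d : int) :
  \sum_i two_blockz c d ord0 i = c * m%:Z + d * x%:Z.
Proof.
rewrite big_split_ord /=; congr (_ + _).
  under eq_bigr do rewrite row_mxEl mxE.
  by rewrite sumr_const card_ord -mulr_natr natz.
under eq_bigr do rewrite row_mxEr mxE.
by rewrite sumr_const card_ord -mulr_natr natz.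
Qed.

Lemma dilate_int_two_blockz (k : nat) (c d t : int) :
  t = k%:Z - (c * m%:Z + d * x%:Z) -> 0 <= t ->
  0 <= Nq%:Z * c + r%:Z * t -> 0 <= Nq%:Z * d + s%:Z * t ->
  dilate_int q k (two_blockz c d).
Proof.
move=> tE t0 c0 d0; rewrite /dilate_int sum_two_blockz -tE; split=> // i.
rewrite total_weight_two_block.
by case: (split_ordP i) => j ->; rewrite ?row_mxEl ?row_mxEr !mxE.
Qed.

(** Lower bounds on the coordinates permitted at level [t] bound [t] itself from above; applied to
    height-one points, this yields the necessary conditions. *)
Lemma dilate_int_two_block_le (k : nat) (p : 'rV[int]_(m + x)) (t c d : int) :
  dilate_int q k p -> k%:Z - \sum_i p ord0 i = t ->
  (forall v, 0 <= Nq%:Z * v + r%:Z * t -> c <= v) ->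
  (forall v, 0 <= Nq%:Z * v + s%:Z * t -> d <= v) ->
  t <= k%:Z - (c * m%:Z + d * x%:Z).
Proof.
move=> [_ Dp] tE cP dP; rewrite -tE lerD2l lerN2 -sum_two_blockz.
apply: ler_sum => i _; have := Dp i; rewrite tE total_weight_two_block.
by case: (split_ordP i) => j ->; rewrite ?row_mxEl ?row_mxEr !mxE => ?;
   [apply: cP | apply: dP].
Qed.

Hypotheses (r0 : (0 < r)%N) (rs : (r < s)%N) (m0 : (0 < m)%N) (x0 : (0 < x)%N).

Let s0 : (0 < s)%N := ltn_trans r0 rs.

Lemma IDP_two_block_s :
  has_IDP (Delta R q) -> (s %| 1 + r * m)%N -> s = (1 + r * m)%N.
Proof.
move=> idp /dvdnP[c cE].
have c0 : (0 < c)%N by nia.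
pose b := (c + x)%N.
have NE : Nq = (s * b)%N by rewrite /b; lia.
have Dz : dilate_int q c (two_blockz 0 (-1)).
  by apply: (@dilate_int_two_blockz _ _ _ b%:Z); rewrite ?NE /b; lia.
have [||p Dp pE] :=
    has_IDP_full_weight (i := rshift m (Ordinal x0)) (two_block_gt0 r0 s0)
      idp c0 Dz.
- by rewrite row_mxEr mxE.
- by rewrite sum_two_blockz total_weight_two_block row_mxEr mxE NE /b; lia.
move: pE; rewrite sum_two_blockz => pE.
have bE : 1 - \sum_j p ord0 j = b%:Z by rewrite pE /b; lia.
have := dilate_int_two_block_le (c := 0) (d := -1) Dp bE.
rewrite NE => h.
(* Since [r b < s b = N], coordinates of [p] are at least 0 in the first block and -1 in the second.
   As [b = c + x], the bound forces [c = 1]. *)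
suff : b%:Z <= 1 + x%:Z by rewrite /b; nia.
have b0 : (0 < b)%N by rewrite /b; lia.
apply: le_trans (h _ _) _; last by lia.
  by move=> v hv; rewrite leNgt; apply/negP => v0; nia.
by move=> v hv; rewrite leNgt; apply/negP => v0; nia.
Qed.

Lemma IDP_two_block_x :
  has_IDP (Delta R q) -> (1 < r)%N -> (r %| 1 + s * x)%N ->
  s = (1 + r * m)%N -> x = (r - 1)%N.
Proof.
move=> idp r1 rdvd sE.
have /dvdnP[k kE] : (r %| 1 + x)%N.
  have : (r %| 1 + x + r * (m * x))%N by congr dvdn: rdvd; rewrite sE; lia.
  by rewrite dvdn_addl // dvdn_mulr.
have k0 : (0 < k)%N by lia.
pose a := (s * k)%N.
have NE : Nq = (r * a)%N by rewrite /a; nia.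
have aE : a = (k + m * (1 + x))%N by rewrite /a sE kE; lia.
(* These are the least coordinates permitted at level [a], and height [k] makes the level
   [k + m + m x = a]. *)
have Dz : dilate_int q k (two_blockz (-1) (- m%:Z)).
  apply: (@dilate_int_two_blockz _ _ _ a%:Z); rewrite ?NE ?aE; nia.
have [||p Dp pE] :=
    has_IDP_full_weight (i := lshift x (Ordinal m0)) (two_block_gt0 r0 s0)
      idp k0 Dz.
- by rewrite row_mxEl mxE.
- by rewrite sum_two_blockz total_weight_two_block row_mxEl mxE NE aE; lia.
move: pE; rewrite sum_two_blockz => pE.
have {}pE : 1 - \sum_j p ord0 j = a%:Z by rewrite pE aE; lia.
have := dilate_int_two_block_le (c := -1) (d := - m%:Z) Dp pE.
rewrite NE => h.
suff : a%:Z <= 1 + m%:Z * (1 + x%:Z) by rewrite aE; nia.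
have a0 : (0 < a)%N by rewrite aE; lia.
apply: le_trans (h _ _) _; last by lia.
  by move=> v hv; rewrite leNgt; apply/negP => v0; nia.
move=> v hv; rewrite leNgt; apply/negP => v0.
(* If [v <= - m - 1], then [r v + s <= 1 - r < 0]; this is where [1 < r] enters. *)
have : 0 <= a%:Z * (r%:Z * v + s%:Z) by move: hv; lia.
rewrite pmulr_rge0 ?ltz_nat // sE; nia.
Qed.

Lemma has_IDP_two_block (a b : nat) : (a * r = Nq)%N -> (b * s = Nq)%N ->
  (forall t, (0 < t)%N -> exists u, [/\ (u <= t)%N,
     u = (1 + (m * (u %/ a) + x * (u %/ b)))%N,
     (u %% a <= t %% a)%N & (u %% b <= t %% b)%N]) ->
  has_IDP (Delta R q).
Proof.
move=> aE bE split_t.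
pose l i := (Nq %/ q ord0 i)%N.
have aE' : (Nq %/ r = a)%N by rewrite -aE mulnK.
have bE' : (Nq %/ s = b)%N by rewrite -bE mulnK.
apply: (@has_IDP_no_carry _ _ _ l) => [i|t t0].
  rewrite total_weight_two_block /l.
  by case: (two_blockP i) => -[j _ ->]; rewrite ?aE' ?bE'.
have [u [ut uE ua ub]] := split_t t t0; exists u; split=> //.
  by rewrite (sum_two_block (fun c => u %/ (Nq %/ c))%N) aE' bE'.
by move=> i; rewrite /l; case: (two_blockP i) => -[j _ ->];
  rewrite ?aE' ?bE'; apply: divn_no_carry.
Qed.

End TwoBlock.

Theorem theorem4p1 (R : realType) (r s m x : nat)
  (hr : (0 < r)%N) (hrs : (r < s)%N) (hm : (0 < m)%N) (hx : (0 < x)%N) :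
  (reflexive_polytope (Delta R (two_block r m s x)) <->
     (r %| 1 + s * x)%N /\ (s %| 1 + r * m)%N) /\
  (reflexive_polytope (Delta R (two_block r m s x)) /\
   has_IDP (Delta R (two_block r m s x)) <->
     (r <> 1%N /\ s = (1 + r * m)%N /\ x = (r - 1)%N) \/
     (r = 1%N /\ s = (1 + m)%N)).
Proof.
have reflP : reflexive_polytope (Delta R (two_block r m s x)) <->
     (r %| 1 + s * x)%N /\ (s %| 1 + r * m)%N.
  have qP := reflexive_DeltaP R (@two_block_gt0 r m s x hr (ltn_trans hr hrs)).
  rewrite total_weight_two_block in qP.
  exact: iff_trans qP (two_block_dvdP _ _ hm hx).
split=> //; split.
  move=> [/reflP[dr ds] idp]; have sE := IDP_two_block_s hr hrs hm hx idp ds.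
  have [r1|r1] := eqVneq r 1%N; first by right; split=> //; rewrite sE r1 mul1n.
  left; split; first exact/eqP.
  by split=> //; apply: (IDP_two_block_x hr hrs hm hx idp) => //; lia.
move=> [[r1 [sE xE]]|[rE sE]].
  split; first apply/reflP; first split.
  (* The quotient comes from [1 + (1 + r m)(r - 1) = r (1 + r m - m)]. *)
  - by apply/dvdnP; exists (1 + r * m - m)%N; rewrite sE xE; nia.
  - by rewrite sE.
  - have r_gt1 : (1 < r)%N by lia.
    apply: (@has_IDP_two_block _ _ _ _ _ hr hrs s r); rewrite ?xE ?sE; try nia.
    by move=> t t0; apply: split_no_carry_gt1.
split; first by apply/reflP; rewrite rE sE mul1n dvd1n.
apply: (@has_IDP_two_block _ _ _ _ _ hr hrs (m.+1 * x.+1) x.+1);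
  rewrite ?rE ?sE; try nia.
by move=> t t0; apply: split_no_carry_r1.
Qed.
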